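(* Let $\psi(s)=\varphi(s)/s$ and let $\gamma\ge\Big(\inf_{t>0}\frac{t\varphi(t)}{\Phi(t)}\Big)^{-1}$. There is $C_1(p^-,p^+,\gamma)>0$ such that for all $\xi,\eta\in\mathbb{R}^d$, $$\langle\psi(|\xi|)\xi-\psi(|\eta|)\eta,\xi-\eta\rangle\ge C_1(p^-,p^+,\gamma)\,\frac{\Phi^{1+\gamma}(|\xi-\eta|)}{\Phi^\gamma(|\xi|+|\eta|)}.$$ If $p^-\ge2$, there is $C_2(p^-,p^+)>0$ such that for all $\xi,\eta\in\mathbb{R}^d$, $$\langle\psi(|\xi|)\xi-\psi(|\eta|)\eta,\xi-\eta\rangle\ge C_2(p^-,p^+)\,\Phi(|\xi-\eta|).$$ The constants depend only on the indicated parameters.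
   Context: $\varphi\in C([0,\infty))\cap C^1((0,\infty))$, $\varphi(s)>0$ for $s>0$, and there are constants $p^-,p^+$ with $0<p^--1\le\frac{s\varphi'(s)}{\varphi(s)}\le p^+-1$ for all $s>0$. $\Phi(s)=\int_0^s\varphi(t)\,dt$; it satisfies $p^-\le\frac{s\varphi(s)}{\Phi(s)}\le p^+$ for $s>0$. $\Phi^{\gamma}(s)$ means $(\Phi(s))^\gamma$. Conventions: $\psi(|0|)0=0$, and the quotient in the first inequality is read as $0$ when $\xi=\eta=0$. *)

(* Defs.v *)
From HB Require Import structures.
From mathcomp Require Import all_boot all_order all_algebra.
From mathcomp Require Import all_classical all_reals all_analysis.

Set Implicit Arguments.
Unset Strict Implicit.
Unset Printing Implicit Defensive.

Import Order.TTheory GRing.Theory Num.Theory.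
Import numFieldNormedType.Exports.

Local Open Scope classical_set_scope.
Local Open Scope ring_scope.

Definition dotv (R : realType) (d : nat) (x y : 'rV[R]_d) : R :=
  \sum_(i < d) x 0 i * y 0 i.

(* The library norm `|x| on 'rV[R]_d is the sup norm, hence a separate
   Euclidean norm. *)
Definition norm2 (R : realType) (d : nat) (x : 'rV[R]_d) : R :=
  Num.sqrt (dotv x x).

(* phi is a total function on R, but only its values on [0, +oo[ are
   constrained or used. *)
Record phi_hyp (R : realType) (pm pp : R) (phi : R -> R) : Prop := PhiHyp {
  phi_cont : {within `[0, +oo[, continuous phi};
  phi_derivable : forall s : R, 0 < s -> derivable phi s 1;
  phi_C1 : forall s : R, 0 < s -> {for s, continuous (derive1 phi)};
  phi_pos : forall s : R, 0 < s -> 0 < phi s;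
  phi_pm_gt1 : 0 < pm - 1;
  phi_index : forall s : R, 0 < s ->
    pm - 1 <= s * derive1 phi s / phi s <= pp - 1
}.

Definition Phi (R : realType) (phi : R -> R) (s : R) : R :=
  (\int[lebesgue_measure]_(t in `[0%R, s]) phi t)%R.

(* psi phi 0 = 0 because x / 0 = 0, which gives psi(|0|)0 = 0. *)
Definition psi (R : realType) (phi : R -> R) (s : R) : R := phi s / s.

Definition index_inf (R : realType) (phi : R -> R) : R :=
  inf [set t * phi t / Phi phi t | t in `]0, +oo[].

Definition pairing (R : realType) (phi : R -> R) (d : nat)
    (xi eta : 'rV[R]_d) : R :=
  dotv (psi phi (norm2 xi) *: xi - psi phi (norm2 eta) *: eta) (xi - eta).

(* For xi = eta = 0 the denominator is 0 (if gam != 0), so the quotient is 0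
   because x / 0 = 0. *)
Definition Phi_quotient (R : realType) (phi : R -> R) (gam : R) (d : nat)
    (xi eta : 'rV[R]_d) : R :=
  (Phi phi (norm2 (xi - eta))) `^ (1 + gam)
  / (Phi phi (norm2 xi + norm2 eta)) `^ gam.

(* Main.v *)
Require Import Defs.
From HB Require Import structures.
From mathcomp Require Import all_boot all_order all_algebra.
From mathcomp Require Import all_classical all_reals all_analysis.
From mathcomp Require Import ring lra.

(** Write a and b for the Euclidean norms of [xi] and [eta], r for that of
    [xi - eta], and S = a + b.  Both inequalities follow from the single lower
    bound [pairing_ge]: the pairing is at least c * psi(S) * r^2, where c
    depends only on [pm] and [pp].

    For that bound, Cauchy-Schwarz splits the pairing into a radial part
    (phi(a) - phi(b)) * (a - b) and an angular part
    (psi(a) + psi(b)) * (a * b - <xi, eta>), both nonnegative, while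
    r^2 = (a - b)^2 + 2 * (a * b - <xi, eta>) splits in the same way.  When
    b <= a, each part dominates, up to a constant, psi(a) times its share of
    r^2 ([radial_gap] for the radial one), and psi(a) is bounded below by a
    multiple of psi(S) because a <= S <= 2 * a ([psi_doubling]).

    The growth of phi enters only through its elasticity s * phi'(s) / phi(s):
    a bound k <= elasticity makes phi(s) / s^k nondecreasing, an upper bound
    makes it nonincreasing.  Cauchy's mean value theorem, applied to ln \o phi
    and ln, gives both ([elasticity_MVT]).

    It remains to compare psi(S) * r^2 with the right-hand sides.  For the
    first one, let q be [index_inf phi]; it bounds the elasticity of Phi from
    below, so Phi(r) / Phi(S) <= (r / S)^q.  Since phi increases,
    Phi(S) <= S * phi(S), which shows q >= 1; with gam >= 1 / q this yields
    q * (1 + gam) >= 2, and the quotient is at most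
    Phi(S) * (r / S)^2 <= psi(S) * r^2 ([Phi_quotient_le]).  For the second
    one, pm >= 2 makes psi nondecreasing, and r <= S gives
    Phi(r) <= psi(r) * r^2 <= psi(S) * r^2 ([Phi_le_quadratic]). *)

Set Implicit Arguments.
Unset Strict Implicit.
Unset Printing Implicit Defensive.

Import Order.TTheory GRing.Theory Num.Theory.
Import numFieldNormedType.Exports.

Local Open Scope ring_scope.

(** * Elasticity and power-type growth *)

Section Elasticity.
Context {R : realType}.
Implicit Types (f : R -> R) (s t k : R).

(** In logarithmic coordinates the elasticity is the derivative, so this is
    Cauchy's mean value theorem for [ln \o f] against [ln]. *)
Lemma elasticity_MVT f s t :
    (forall x, 0 < x -> derivable f x 1) -> (forall x, 0 < x -> 0 < f x) ->
    0 < s -> s < t ->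
  exists2 c, 0 < c & f s = (s / t) `^ (c * derive1 f c / f c) * f t.
Proof.
move=> df f0 s0 st; have t0 := lt_trans s0 st.
have lnfD (x : R) : 0 < x ->
    is_derive x 1 (@ln R \o f) ((f x)^-1 * derive1 f x).
  move=> x0; apply: is_derive1_comp; first exact/is_derive1_ln/f0.
  by rewrite derive1E; exact/derivableP/df.
have inpos (x : R) : x \in `]s, t[ -> 0 < x.
  by rewrite in_itv/= => /andP[/(lt_trans s0)].
have inposc (x : R) : x \in `[s, t] -> 0 < x.
  by rewrite in_itv/= => /andP[/(lt_le_trans s0)].
have [||x xst|x /inpos x0|x /inpos x0|c /inpos c0 E] :=
  @cauchy_MVT R (@ln R \o f) (fun x => (f x)^-1 * derive1 f x) (@ln R)
    (fun x => x^-1) s t st.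
- apply: derivable_within_continuous => x /inposc x0.
  by have [] := lnfD x x0.
- apply: derivable_within_continuous => x /inposc x0.
  by have [] := is_derive1_ln x0.
- exact/lnfD/inpos.
- exact: is_derive1_ln.
- by rewrite invr_neq0 ?gt_eqF.
exists c => //.
have lnts : ln t - ln s != 0 by rewrite subr_eq0 gt_eqF// ltr_ln ?posrE.
have {}E : c * derive1 f c / f c * (ln t - ln s) = ln (f t) - ln (f s).
  rewrite -[RHS](divfK lnts) -E invrK; congr (_ * _).
  by rewrite mulrC mulrA mulrAC.
apply: (@ln_inj R); rewrite ?posrE ?mulr_gt0 ?powR_gt0 ?divr_gt0 ?f0//.
rewrite lnM ?posrE ?powR_gt0 ?divr_gt0 ?f0// ln_powR ln_div ?posrE//.
by rewrite -opprB mulrN E opprB subrK.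
Qed.

Lemma scale_elasticity_ge f k s t :
    (forall x, 0 < x -> derivable f x 1) -> (forall x, 0 < x -> 0 < f x) ->
    (forall x, 0 < x -> k <= x * derive1 f x / f x) ->
    0 < s -> s <= t -> f s <= (s / t) `^ k * f t.
Proof.
move=> df f0 fk s0; rewrite le_eqVlt => /predU1P[<-|st].
  by rewrite divff ?gt_eqF// powR1 mul1r.
have t0 := lt_trans s0 st; have [c c0 ->] := elasticity_MVT df f0 s0 st.
rewrite ler_pM2r ?f0// ger_powR ?fk//.
by rewrite divr_gt0//= ler_pdivrMr// mul1r ltW.
Qed.

Lemma scale_elasticity_le f k s t :
    (forall x, 0 < x -> derivable f x 1) -> (forall x, 0 < x -> 0 < f x) ->
    (forall x, 0 < x -> x * derive1 f x / f x <= k) ->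
    0 < s -> s <= t -> (s / t) `^ k * f t <= f s.
Proof.
move=> df f0 fk s0; rewrite le_eqVlt => /predU1P[<-|st].
  by rewrite divff ?gt_eqF// powR1 mul1r.
have t0 := lt_trans s0 st; have [c c0 ->] := elasticity_MVT df f0 s0 st.
rewrite ler_pM2r ?f0// ger_powR ?fk//.
by rewrite divr_gt0//= ler_pdivrMr// mul1r ltW.
Qed.

(** A concave power lies below its tangent at 1; obtained here from the
    concavity of [ln] between x and 1. *)
Lemma powR_le_tangent1 (x k : R) : 0 < x -> 0 <= k <= 1 ->
  x `^ k <= 1 + k * (x - 1).
Proof.
move=> x0 /andP[k0 k1].
have h : k * ln x <= ln (k * x + (1 - k)).
  have := @concave_ln R (Itv01 k0 k1) x 1 x0 ltr01.
  by rewrite !convRE/= ln1 mulr0 addr0 mulr1.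
have M0 : 0 < k * x + (1 - k).
  have [->|kn0] := eqVneq k 0; first by rewrite mul0r subr0 add0r.
  by rewrite ltr_wpDr ?subr_ge0// mulr_gt0// lt0r kn0.
rewrite (_ : 1 + _ = k * x + (1 - k)); last by ring.
by rewrite -ler_ln ?posrE ?powR_gt0// ln_powR.
Qed.

End Elasticity.

(** * Euclidean inner product and norm *)

Section Euclidean.
Context {R : realType} {d : nat}.
Implicit Types x y z : 'rV[R]_d.

Lemma dotvC x y : dotv x y = dotv y x.
Proof. by apply: eq_bigr => i _; rewrite mulrC. Qed.

Lemma dotvDl x y z : dotv (x + y) z = dotv x z + dotv y z.
Proof. by rewrite -big_split; apply: eq_bigr => i _; rewrite !mxE mulrDl. Qed.

Lemma dotvZl (k : R) x y : dotv (k *: x) y = k * dotv x y.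
Proof. by rewrite mulr_sumr; apply: eq_bigr => i _; rewrite !mxE mulrA. Qed.

Lemma dotvBl x y z : dotv (x - y) z = dotv x z - dotv y z.
Proof. by rewrite -scaleN1r dotvDl dotvZl mulN1r. Qed.

Lemma dotvBr x y z : dotv x (y - z) = dotv x y - dotv x z.
Proof. by rewrite dotvC dotvBl !(dotvC _ x). Qed.

Lemma dotv_ge0 x : 0 <= dotv x x.
Proof. by apply: sumr_ge0 => i _; rewrite -expr2 sqr_ge0. Qed.

Lemma norm2_ge0 x : 0 <= norm2 x. Proof. exact: sqrtr_ge0. Qed.

Lemma sqr_norm2 x : norm2 x ^+ 2 = dotv x x.
Proof. exact/sqr_sqrtr/dotv_ge0. Qed.

Lemma norm2_eq0 x : norm2 x = 0 -> x = 0.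
Proof.
move=> x0; have /psumr_eq0P xx0 : dotv x x = 0 by rewrite -sqr_norm2 x0 expr0n.
apply/rowP => i; rewrite mxE; apply/eqP; rewrite -sqrf_eq0 expr2; apply/eqP.
by apply: xx0 => // j _; rewrite -expr2 sqr_ge0.
Qed.

Lemma norm2N x : norm2 (- x) = norm2 x.
Proof. by rewrite /norm2 -scaleN1r dotvZl dotvC dotvZl mulrA mulrNN !mul1r. Qed.

Lemma dotv_le_norm2 x y : dotv x y <= norm2 x * norm2 y.
Proof.
have [/eqP|n0] := eqVneq (norm2 x * norm2 y) 0.
  rewrite mulf_eq0 => /orP[]/eqP n0; rewrite n0 (norm2_eq0 n0) ?mul0r ?mulr0.
    by rewrite -[0 : 'rV__](scale0r 0) dotvZl mul0r.
  by rewrite dotvC -[0 : 'rV__](scale0r 0) dotvZl mul0r.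
have {n0}n0 : 0 < norm2 x * norm2 y by rewrite lt0r n0 mulr_ge0 ?norm2_ge0.
(* Expanding this square gives (2 a b) (a b - m) with a, b the norms. *)
have := dotv_ge0 (norm2 y *: x - norm2 x *: y).
rewrite dotvBl !dotvBr !dotvZl !(dotvC _ (_ *: _)) !dotvZl -!sqr_norm2 (dotvC y).
move: (norm2 x) (norm2 y) (dotv x y) n0 => a b m n0 h.
have : 0 <= (a * b) * (a * b - m) by lra.
by rewrite pmulr_rge0// subr_ge0.
Qed.

Lemma sqr_norm2B x y :
  norm2 (x - y) ^+ 2 = norm2 x ^+ 2 + norm2 y ^+ 2 - dotv x y *+ 2.
Proof. by rewrite !sqr_norm2 dotvBl !dotvBr (dotvC y x); ring. Qed.

Lemma norm2B_le x y : norm2 (x - y) <= norm2 x + norm2 y.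
Proof.
rewrite -ler_sqr ?nnegrE ?addr_ge0 ?norm2_ge0// sqr_norm2B.
have := dotv_le_norm2 (- x) y; rewrite norm2N -scaleN1r dotvZl mulN1r.
by rewrite sqrrD; lra.
Qed.

End Euclidean.

(** * Growth of phi and Phi *)

(** The lower elasticity bound of phi, capped at 1 so that the power with this
    exponent is concave. *)
Definition index_cap (R : realType) (pm : R) : R := Num.min 1 (pm - 1).

Section Growth.
Context {R : realType} {pm pp : R} {phi : R -> R}.
Context (H : phi_hyp pm pp phi).
Implicit Types s t : R.

Let phi_derivable' s : 0 < s -> derivable phi s 1.
Proof. exact: (phi_derivable H). Qed.

Let phi_pos' s : 0 < s -> 0 < phi s. Proof. exact: (phi_pos H). Qed.

Let phi_index_ge s : 0 < s -> pm - 1 <= s * derive1 phi s / phi s.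
Proof. by move=> /(phi_index H)/andP[]. Qed.

Let phi_index_le s : 0 < s -> s * derive1 phi s / phi s <= pp - 1.
Proof. by move=> /(phi_index H)/andP[]. Qed.

Lemma pp_gt1 : 0 < pp - 1.
Proof.
apply: (lt_le_trans (phi_pm_gt1 H)).
exact: le_trans (phi_index_ge ltr01) (phi_index_le ltr01).
Qed.

Lemma phi_scale_ge k s t : k <= pm - 1 -> 0 < s -> s <= t ->
  phi s <= (s / t) `^ k * phi t.
Proof.
move=> kpm; apply: scale_elasticity_ge => // x x0.
exact: le_trans kpm (phi_index_ge x0).
Qed.

Lemma phi_nondecreasing s t : 0 < s -> s <= t -> phi s <= phi t.
Proof.
move=> s0 st; have := phi_scale_ge (ltW (phi_pm_gt1 H)) s0 st.
by rewrite powRr0 mul1r.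
Qed.

Lemma phi_scale_le s t : 0 < s -> s <= t ->
  (s / t) `^ (pp - 1) * phi t <= phi s.
Proof. exact: scale_elasticity_le. Qed.

Lemma psi_ge0 s : 0 <= s -> 0 <= psi phi s.
Proof.
rewrite le_eqVlt /psi => /predU1P[<-|s0]; first by rewrite invr0 mulr0.
by rewrite divr_ge0 ?ltW ?phi_pos'.
Qed.

Lemma phi_integrable s :
  lebesgue_measure.-integrable `[0, s] (EFin \o phi).
Proof.
apply: continuous_compact_integrable; first exact: segment_compact.
apply: continuous_subspaceW (phi_cont H).
by apply: subset_itvl; rewrite bnd_simp.
Qed.

Lemma Phi0 : Phi phi 0 = 0.
Proof. by rewrite /Phi set_itv1 Rintegral_set1. Qed.

Lemma is_derive_Phi s : 0 < s -> is_derive s 1 (Phi phi) (phi s).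
Proof.
move=> s0; have cphi : {for s, continuous phi}.
  by apply/differentiable_continuous/derivable1_diffP/phi_derivable'.
have ss1 : s < s + 1 by rewrite ltrDl.
have [dPhi PhiE] := continuous_FTC1_closed ss1 (phi_integrable _) s0 cphi.
by apply: DeriveDef; [exact: dPhi|rewrite -derive1E; exact: PhiE].
Qed.

(** Both the positivity of Phi and the upper bound s * phi(s) are read off from
    this intermediate value. *)
Lemma Phi_MVT s : 0 < s -> exists2 c, 0 < c <= s & Phi phi s = s * phi c.
Proof.
move=> s0.
have [x||c] := @MVT R (Phi phi) phi 0 s s0.
- by rewrite in_itv/= => /andP[x0 _]; exact: is_derive_Phi.
- exact/parameterized_integral_continuous/phi_integrable/ltW.
rewrite in_itv/= => /andP[c0 cs]; rewrite Phi0 !subr0 mulrC => ->.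
by exists c; rewrite // c0 ltW.
Qed.

Lemma Phi_gt0 s : 0 < s -> 0 < Phi phi s.
Proof.
by move=> s0; have [c /andP[c0 _] ->] := Phi_MVT s0; rewrite mulr_gt0 ?phi_pos'.
Qed.

Lemma Phi_le s : 0 < s -> Phi phi s <= s * phi s.
Proof.
move=> s0; have [c /andP[c0 cs] ->] := Phi_MVT s0.
by rewrite ler_pM2l// phi_nondecreasing.
Qed.

Lemma index_inf_ge1 : 1 <= index_inf phi.
Proof.
apply: lb_le_inf.
  by exists (1 * phi 1 / Phi phi 1), 1; rewrite //= in_itv/= ltr01.
move=> y [s /=]; rewrite in_itv/= andbT => s0 <-.
by rewrite ler_pdivlMr ?Phi_gt0// mul1r Phi_le.
Qed.

Lemma index_inf_le s : 0 < s -> index_inf phi <= s * phi s / Phi phi s.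
Proof.
move=> s0; apply: ge_inf; last by exists s; rewrite //= in_itv/= s0.
exists 0 => y [t /=]; rewrite in_itv/= andbT => t0 <-.
by rewrite divr_ge0 ?mulr_ge0 ?ltW ?Phi_gt0 ?phi_pos'.
Qed.

(** As Phi' = phi, the set whose infimum is [index_inf phi] consists of the
    elasticities of Phi. *)
Lemma Phi_scale s t : 0 < s -> s <= t ->
  Phi phi s <= (s / t) `^ index_inf phi * Phi phi t.
Proof.
have dPhi x : 0 < x -> derivable (Phi phi) x 1 by move=> /is_derive_Phi[].
apply: scale_elasticity_ge dPhi Phi_gt0 _ => x x0.
have [_ dPhiE] := is_derive_Phi x0.
by rewrite derive1E dPhiE index_inf_le.
Qed.

(** * Scalar bounds for psi *)

Let index_cap_gt0 : 0 < index_cap pm.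
Proof. by rewrite lt_min ltr01 (phi_pm_gt1 H). Qed.

Let index_cap_le1 : index_cap pm <= 1.
Proof. by rewrite /index_cap ge_min lexx. Qed.

Lemma psiM s : 0 < s -> psi phi s * s = phi s.
Proof. by move=> s0; rewrite divfK ?gt_eqF. Qed.

(** The growth of phi gives phi(b) <= (b / a)^k * phi(a) with k the capped
    index, and the tangent bound turns the power into an affine function of
    b / a.  Writing psi(b) * b for phi(b) covers b = 0, where the product is 0
    whatever phi(0) is. *)
Lemma radial_gap a b : 0 < a -> 0 <= b <= a ->
  index_cap pm * psi phi a * (a - b) <= psi phi a * a - psi phi b * b.
Proof.
move=> a0 /andP[]; rewrite le_eqVlt => /predU1P[<- _|b0 ba].
  rewrite mulr0 !subr0 -mulrA ler_piMl// mulr_ge0 ?psi_ge0 ?ltW//.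
have gap : phi b <= (1 + index_cap pm * (b / a - 1)) * phi a.
  have cap_le : index_cap pm <= pm - 1 by rewrite ge_min lexx orbT.
  apply: (le_trans (phi_scale_ge cap_le b0 ba)).
  rewrite ler_pM2r ?phi_pos'//; apply: powR_le_tangent1; rewrite ?divr_gt0//.
  by rewrite ltW//= index_cap_le1.
rewrite !psiM// lerBrDr -lerBrDl; apply: (le_trans gap).
rewrite le_eqVlt /psi; apply/orP; left; apply/eqP; field.
by rewrite gt_eqF.
Qed.

Lemma psi_doubling a S : 0 < a -> a <= S <= 2 * a ->
  2^-1 `^ (pp - 1) * psi phi S <= psi phi a.
Proof.
move=> a0 /andP[aS S2a]; have S0 := lt_le_trans a0 aS.
have : 2^-1 `^ (pp - 1) * phi S <= phi a.
  apply: le_trans (phi_scale_le a0 aS); rewrite ler_pM2r ?phi_pos'//.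
  have half_le : 2^-1 <= a / S by rewrite ler_pdivlMr// ler_pdivrMl.
  apply: ge0_ler_powR => //; first exact/ltW/pp_gt1.
    by rewrite nnegrE invr_ge0.
  by rewrite nnegrE divr_ge0// ltW.
move=> /le_trans le_phi; rewrite /psi mulrA ler_pM ?mulr_ge0 ?powR_ge0//.
- by rewrite ltW ?phi_pos'.
- by rewrite invr_ge0 ltW.
- exact: le_phi.
- by rewrite lef_pV2.
Qed.

(** * The pairing *)

Section Pairing.
Context {d : nat}.
Implicit Types xi eta : 'rV[R]_d.

(** The splitting into a radial and an angular part. *)
Lemma pairingE xi eta :
  pairing phi xi eta =
    (psi phi (norm2 xi) * norm2 xi - psi phi (norm2 eta) * norm2 eta) *
      (norm2 xi - norm2 eta) +
    (psi phi (norm2 xi) + psi phi (norm2 eta)) *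
      (norm2 xi * norm2 eta - dotv xi eta).
Proof.
rewrite /pairing dotvBl !dotvZl !dotvBr (dotvC eta xi) -!sqr_norm2.
by ring.
Qed.

Lemma pairingC xi eta : pairing phi xi eta = pairing phi eta xi.
Proof. by rewrite !pairingE (dotvC eta xi); ring. Qed.

(** The factor 2 is lost on the angular part: only the psi of the larger norm
    is kept there, while a * b - <xi, eta> counts twice in r^2. *)
Lemma pairing_ge xi eta :
  index_cap pm / 2 * 2^-1 `^ (pp - 1) *
    (psi phi (norm2 xi + norm2 eta) * norm2 (xi - eta) ^+ 2)
  <= pairing phi xi eta.
Proof.
wlog ba : xi eta / norm2 eta <= norm2 xi.
  move=> ge; have [/ge//|/ltW/ge] := leP (norm2 eta) (norm2 xi).
  by rewrite pairingC (addrC (norm2 xi)) -(norm2N (xi - eta)) opprB.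
rewrite sqr_norm2B pairingE; have := dotv_le_norm2 xi eta.
move: (norm2 xi) (norm2 eta) (dotv xi eta) ba (norm2_ge0 xi) (norm2_ge0 eta).
move=> a b m ba; rewrite le_eqVlt => /predU1P[a0|a0] b0 mab.
  have {}b0 : b = 0 by apply/le_anti; rewrite b0 [X in _ <= X]a0 ba.
  by rewrite -a0 b0 addr0 /psi invr0 !(mulr0, mul0r, addr0).
have gap : index_cap pm * psi phi a * (a - b) <= psi phi a * a - psi phi b * b.
  by apply: radial_gap; rewrite ?b0.
have dbl : 2^-1 `^ (pp - 1) * psi phi (a + b) <= psi phi a.
  by apply: psi_doubling; rewrite // lerDl b0 mulr2n mulrDl mul1r lerD2l.
have pa := psi_ge0 (ltW a0); have pb := psi_ge0 b0.
set r2 := _ - _ *+ 2.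
have r2E : r2 = (a - b) ^+ 2 + (a * b - m) *+ 2 by rewrite /r2; ring.
have r20 : 0 <= r2 by rewrite r2E addr_ge0 ?sqr_ge0// mulrn_wge0// subr_ge0.
apply: (@le_trans _ _ (index_cap pm / 2 * psi phi a * r2)).
  rewrite mulrA ler_wpM2r// -mulrA.
  by rewrite ler_pM2l ?divr_gt0.
apply: (@le_trans _ _ (index_cap pm * psi phi a * (a - b) * (a - b) +
    index_cap pm * psi phi a * (a * b - m))).
  rewrite r2E -subr_ge0.
  rewrite (_ : _ - _ = index_cap pm / 2 * psi phi a * (a - b) ^+ 2).
    by rewrite mulr_ge0 ?sqr_ge0// mulr_ge0// divr_ge0 ?ltW.
  by field.
apply: lerD; first by rewrite ler_wpM2r ?subr_ge0.
rewrite ler_wpM2r ?subr_ge0// (@le_trans _ _ (psi phi a))// ?lerDl//.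
by rewrite ler_piMl.
Qed.

(** With q = [index_inf phi] >= 1, the condition gam >= 1 / q brings the
    exponent q * (1 + gam) up to 2, so that (r / S)^(q * (1 + gam)) is at most
    (r / S)^2. *)
Lemma Phi_quotient_le gam xi eta : (index_inf phi)^-1 <= gam ->
  Phi_quotient phi gam xi eta <=
    psi phi (norm2 xi + norm2 eta) * norm2 (xi - eta) ^+ 2.
Proof.
move=> gam_ge; have q1 := index_inf_ge1; have q0 := lt_le_trans ltr01 q1.
have gam0 : 0 < gam by apply: lt_le_trans gam_ge; rewrite invr_gt0.
have q2 : 2 <= index_inf phi * (1 + gam).
  move: gam_ge; rewrite -(ler_pM2l q0) divff ?gt_eqF// => gam_ge.
  by rewrite mulrDr mulr1 lerD.
rewrite /Phi_quotient; move: (norm2B_le xi eta) (norm2_ge0 (xi - eta)).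
move: (norm2 (xi - eta)) (norm2 xi + norm2 eta) => r S rS.
rewrite le_eqVlt => /predU1P[<-|r0].
  by rewrite Phi0 powR0 ?gt_eqF ?addr_gt0// mul0r expr0n mulr0.
have S0 := lt_le_trans r0 rS; have PS0 := Phi_gt0 S0; have Pr0 := Phi_gt0 r0.
have rS01 : 0 < r / S <= 1 by rewrite divr_gt0//= ler_pdivrMr// mul1r.
apply: (@le_trans _ _ (Phi phi S * (r / S) ^+ 2)); last first.
  rewrite /psi expr_div_n (_ : _ / S * _ = S * phi S * (r ^+ 2 / S ^+ 2)).
    by rewrite ler_wpM2r ?Phi_le// divr_ge0 ?sqr_ge0.
  by field; rewrite gt_eqF.
(* The quotient is Phi(S) times a power of Phi(r) / Phi(S), to which the
   growth of Phi applies. *)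
have -> : Phi phi r `^ (1 + gam) / Phi phi S `^ gam =
    Phi phi S * (Phi phi r / Phi phi S) `^ (1 + gam).
  rewrite -{1}(divfK (lt0r_neq0 PS0) (Phi phi r)).
  rewrite [in LHS]powRM ?divr_ge0 ?ltW//.
  rewrite [Phi phi S `^ (1 + _)]powRD ?lt0r_neq0 ?implybT// powRr1 ?ltW//.
  by rewrite mulrA mulfK ?gt_eqF ?powR_gt0// mulrC.
rewrite ler_pM2l// -powR_mulrn ?divr_ge0 ?(ltW r0) ?(ltW S0)//.
apply: (@le_trans _ _ ((r / S) `^ (index_inf phi * (1 + gam)))); last first.
  by rewrite ger_powR.
rewrite powRrM; apply: ge0_ler_powR; rewrite ?nnegrE ?powR_ge0//.
- by rewrite ltW ?addr_gt0.
- by rewrite divr_ge0// ltW.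
- by rewrite ler_pdivrMr// Phi_scale.
Qed.

(** With pm - 1 >= 1, phi(r) <= (r / S) * phi(S) for r <= S. *)
Lemma Phi_le_quadratic xi eta : 2 <= pm ->
  Phi phi (norm2 (xi - eta)) <=
    psi phi (norm2 xi + norm2 eta) * norm2 (xi - eta) ^+ 2.
Proof.
move=> pm2; move: (norm2B_le xi eta) (norm2_ge0 (xi - eta)).
move: (norm2 (xi - eta)) (norm2 xi + norm2 eta) => r S rS.
rewrite le_eqVlt => /predU1P[<-|r0]; first by rewrite Phi0 expr0n mulr0.
have S0 := lt_le_trans r0 rS; apply: (le_trans (Phi_le r0)).
rewrite (_ : _ * r ^+ 2 = r * (r / S * phi S)); last by rewrite /psi; ring.
rewrite ler_pM2l// -[r / S]powRr1; last by rewrite divr_ge0 ?ltW.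
by apply: phi_scale_ge => //; lra.
Qed.

End Pairing.

End Growth.

(** The constant has to be chosen before phi.  When pm <= 1 the explicit one
    is not positive, but then no phi satisfies the hypotheses. *)
Lemma pairing_ge_psi (R : realType) (pm pp : R) : exists c : R, 0 < c /\
  forall phi : R -> R, phi_hyp pm pp phi ->
    forall (d : nat) (xi eta : 'rV[R]_d),
      c * (psi phi (norm2 xi + norm2 eta) * norm2 (xi - eta) ^+ 2)
        <= pairing phi xi eta.
Proof.
have [pm1|pm1] := ltP 0 (pm - 1); last first.
  exists 1; split=> // phi /phi_pm_gt1.
  by rewrite ltNge pm1.
exists (index_cap pm / 2 * 2^-1 `^ (pp - 1)); split.
  by rewrite !mulr_gt0 ?powR_gt0 ?invr_gt0// lt_min ltr01.
by move=> phi H d xi eta; exact: pairing_ge.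
Qed.

Theorem lemma12 (R : realType) (pm pp : R) :
  (forall gam : R,
    exists C1 : R, 0 < C1 /\
      forall phi : R -> R, phi_hyp pm pp phi ->
        (index_inf phi)^-1 <= gam ->
        forall (d : nat) (xi eta : 'rV[R]_d),
          C1 * Phi_quotient phi gam xi eta <= pairing phi xi eta)
  /\
  (2 <= pm ->
    exists C2 : R, 0 < C2 /\
      forall phi : R -> R, phi_hyp pm pp phi ->
        forall (d : nat) (xi eta : 'rV[R]_d),
          C2 * Phi phi (norm2 (xi - eta)) <= pairing phi xi eta).
Proof.
have [c [c0 cP]] := pairing_ge_psi pm pp.
split=> [gam|pm2]; exists c; split=> // phi H.
  move=> gam_ge d xi eta; apply: le_trans (cP phi H d xi eta).
  by rewrite ler_pM2l// (Phi_quotient_le H).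
move=> d xi eta; apply: le_trans (cP phi H d xi eta).
by rewrite ler_pM2l// (Phi_le_quadratic H).
Qed.
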